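(* Consider the recurrence relation $$\frac{x-a_{n+1}}{\sqrt{a_{n+1}^2-1}}\,u_{n+1}(x)+\left(\frac{a_{n+1}x-1}{\sqrt{a_{n+1}^2-1}}+\frac{a_nx-1}{\sqrt{a_n^2-1}}\right)u_n(x)+\frac{x-a_n}{\sqrt{a_n^2-1}}\,u_{n-1}(x)=0,\qquad n\ge 1. \qquad ( * )$$ Both sequences $u_n=T_n$ ($n\ge0$) and $u_n=U_{n-1}$ ($n\ge 0$) satisfy $( * )$. Moreover, the solution $u_n$ of $( * )$ with initial conditions $$u_0=1,\qquad u_1=\frac{1-a_1x}{x-a_1}$$ is $u_n=T_n$, and the solution $u_n$ of $( * )$ with initial conditions $$u_0=0,\qquad u_1=-\frac{\sqrt{a_1^2-1}}{x-a_1}$$ is $u_n=U_{n-1}$.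
   Context: Let $\{a_k\}_{k=1}^\infty$ be a sequence of distinct points of $\mathbb{C}\setminus[-1,1]$. The symbol $\sqrt{x^2-1}$ denotes the branch analytic on $\mathbb{C}\setminus[-1,1]$ with $\sqrt{x^2-1}\sim x$ as $x\to\infty$. Put $c_k=a_k-\sqrt{a_k^2-1}$, so $0<|c_k|<1$ and $a_k=\frac12(c_k+c_k^{-1})$. Define $f_0(z)\equiv1$ and $f_n(z)=\prod_{k=1}^n\frac{z-c_k}{1-c_kz}$ (no complex conjugation). With $x=\frac12(z+z^{-1})$, the Chebyshev rational functions are $$T_n(x)=\frac12\left(f_n(z)+\frac1{f_n(z)}\right)\ (n\ge 0),\qquad U_n(x)=\frac{1}{z-z^{-1}}\left(f_{n+1}(z)-\frac{1}{f_{n+1}(z)}\right)\ (n\ge -1),$$ which are well defined since both expressions are invariant under $z\mapsto 1/z$; in particular $U_{-1}=0$. *)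

(* Defs.v *)
From HB Require Import structures.
From mathcomp Require Import all_boot all_order all_algebra.
From mathcomp Require Import complex.
From mathcomp Require Import all_classical all_reals all_analysis.
From mathcomp Require Import ring.

Set Implicit Arguments.
Unset Strict Implicit.
Unset Printing Implicit Defensive.

Import Order.TTheory GRing.Theory Num.Theory.
Import numFieldNormedType.Exports.

Local Open Scope classical_set_scope.
Local Open Scope ring_scope.

Section ChebyshevRational.
Variable R : realType.
Local Notation C := R[i].

(* In the partial order of C, y <= z means Im y = Im z and Re y <= Re z. *)
Definition slit : set C := [set x | -1 <= x <= 1].

(* Analytic: complex differentiable at each point of the open set ~` slit. *)
Definition sqrt_branch (s : C -> C) : Prop :=
  [/\ forall x, ~ slit x -> s x ^+ 2 = x ^+ 2 - 1,
      forall x, ~ slit x -> derivable (s : C^o -> C^o) x 1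
    & forall e : C, 0 < e ->
        exists2 M : C, 0 < M & forall x, M < `|x| -> `|s x / x - 1| < e].

Definition cpar (s : C -> C) (a : nat -> C) (k : nat) : C := a k - s (a k).

Definition f_cheb (c : nat -> C) (n : nat) (z : C) : C :=
  \prod_(1 <= k < n.+1) ((z - c k) / (1 - c k * z)).

Definition joukowski (z : C) : C := 2^-1 * (z + z^-1).

(* Some z with x = (z + 1/z)/2; the other one is 1/z, see [chebTE], [chebUE]. *)
Definition joukowski_inv (x : C) : C :=
  xget 1 [set z | z != 0 /\ joukowski z = x].

Definition chebT (c : nat -> C) (n : nat) (x : C) : C :=
  let z := joukowski_inv x in 2^-1 * (f_cheb c n z + (f_cheb c n z)^-1).

Definition chebU_formula (c : nat -> C) (n : int) (x : C) : C :=
  let z := joukowski_inv x in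
  let f := f_cheb c (absz (n + 1)) z in (z - z^-1)^-1 * (f - f^-1).

(* Meant for n >= -1.  The formula reads 0/0 at the removable singularities
   x = 1 and x = -1 (that is z = 1 and z = -1), where the rational function U_n
   takes the limit value. *)
Definition chebU (c : nat -> C) (n : int) (x : C) : C :=
  if x ^+ 2 == 1 then
    lim (chebU_formula c n y @[y --> (x : C^o)^'] : set_system C^o)
  else chebU_formula c n x.

(* x is not one of the possible poles a_1, ..., a_n of T_n and U_(n-1). *)
Definition off_poles (a : nat -> C) (n : nat) (x : C) : Prop :=
  forall k : nat, (1 <= k <= n)%N -> x != a k.

Definition solves_recurrence (s : C -> C) (a : nat -> C) (u : nat -> C -> C) :
    Prop :=
  forall (n : nat) (x : C), (1 <= n)%N -> off_poles a n.+1 x ->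
    (x - a n.+1) / s (a n.+1) * u n.+1 x
    + ((a n.+1 * x - 1) / s (a n.+1) + (a n * x - 1) / s (a n)) * u n x
    + (x - a n) / s (a n) * u n.-1 x = 0.

Lemma joukowski_surj (x : C) : exists z, z != 0 /\ joukowski z = x.
Proof.
have e : sqrtC (x ^+ 2 - 1) ^+ 2 = x ^+ 2 - 1 by rewrite sqrtCK.
move: e; set r := sqrtC _ => e.
have e1 : (x + r) * (x - r) = 1 by rewrite mulrC -subr_sqr e; ring.
have z0 : x + r != 0.
  by apply/eqP => h; move: e1; rewrite h mul0r => /esym/eqP; rewrite oner_eq0.
exists (x + r); split=> //; rewrite /joukowski.
have -> : (x + r)^-1 = x - r by apply: (mulfI z0); rewrite e1 divff.
by field.
Qed.

Lemma joukowski_invP (x : C) :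
  joukowski_inv x != 0 /\ joukowski (joukowski_inv x) = x.
Proof. exact: (xgetPex 1 (joukowski_surj x)). Qed.

Lemma joukowskiV (z : C) : joukowski z^-1 = joukowski z.
Proof. by rewrite /joukowski invrK addrC. Qed.

Lemma joukowski_eq (z w : C) : z != 0 -> w != 0 ->
  joukowski z = joukowski w -> z = w \/ z = w^-1.
Proof.
move=> z0 w0 e.
have : (z - w) * (z - w^-1) = 0.
  have -> : (z - w) * (z - w^-1) = 2 * z * (joukowski z - joukowski w).
    by rewrite /joukowski; field; rewrite z0 w0.
  by rewrite e subrr mulr0.
by move/eqP; rewrite mulf_eq0 !subr_eq0 => /orP[]/eqP; [left|right].
Qed.

Lemma joukowski_sqr1 (z : C) : z != 0 ->
  (joukowski z ^+ 2 == 1) = (z - z^-1 == 0).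
Proof.
move=> z0; rewrite -subr_eq0.
have -> : joukowski z ^+ 2 - 1 = (2^-1 * (z - z^-1)) ^+ 2.
  by rewrite /joukowski; field.
by rewrite sqrf_eq0 mulf_eq0 invr_eq0 pnatr_eq0.
Qed.

Lemma f_chebV (c : nat -> C) n (z : C) : z != 0 ->
  f_cheb c n z^-1 = (f_cheb c n z)^-1.
Proof.
move=> z0; rewrite /f_cheb -prodfV; apply: eq_bigr => k _.
rewrite invf_div.
have -> : z^-1 - c k = z^-1 * (1 - c k * z) by field.
have -> : 1 - c k / z = z^-1 * (z - c k) by field.
by rewrite -mulf_div divff ?mul1r // invr_eq0.
Qed.

Lemma chebTE (c : nat -> C) n (z : C) : z != 0 ->
  chebT c n (joukowski z) = 2^-1 * (f_cheb c n z + (f_cheb c n z)^-1).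
Proof.
move=> z0; rewrite /chebT; have [w0 ew] := joukowski_invP (joukowski z).
case: (joukowski_eq w0 z0 ew) => -> //=.
by rewrite f_chebV // invrK addrC.
Qed.

Lemma chebU_formulaE (c : nat -> C) n (z : C) : z != 0 ->
  chebU_formula c n (joukowski z) =
  (z - z^-1)^-1 * (f_cheb c (absz (n + 1)) z - (f_cheb c (absz (n + 1)) z)^-1).
Proof.
move=> z0; rewrite /chebU_formula.
have [w0 ew] := joukowski_invP (joukowski z).
case: (joukowski_eq w0 z0 ew) => -> //=.
rewrite f_chebV // !invrK -[z^-1 - z]opprB -[_^-1 - f_cheb _ _ _]opprB.
by rewrite invrN mulrNN.
Qed.

Lemma chebUE (c : nat -> C) n (z : C) : z != 0 -> z ^+ 2 != 1 ->
  chebU c n (joukowski z) =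
  (z - z^-1)^-1 * (f_cheb c (absz (n + 1)) z - (f_cheb c (absz (n + 1)) z)^-1).
Proof.
move=> z0 z1; rewrite /chebU joukowski_sqr1 // ifN ?chebU_formulaE //.
apply: contra z1; rewrite subr_eq0 => /eqP e.
by rewrite expr2 {2}e divff.
Qed.

Lemma joukowski_slit (z : C) : `|z| = 1 -> slit (joukowski z).
Proof.
move=> z1.
have zR : z^-1 = z^* by rewrite invC_norm z1 expr1n invr1 mul1r.
have -> : joukowski z = 'Re z by rewrite /joukowski zR ReE mulrC.
rewrite /slit /= -real_ler_norml ?Creal_Re //.
by rewrite -z1 leif_normC_Re_Creal.
Qed.

Lemma joukowski_disc (x : C) :
  exists z, [/\ z != 0, `|z| <= 1 & joukowski z = x].
Proof.
have [z [z0 <-]] := joukowski_surj x.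
have /orP[z1|z1] : (`|z| <= 1) || (1 <= `|z|).
  by apply: real_leVge; rewrite ?normr_real ?real1.
  by exists z.
exists z^-1; split; rewrite ?invr_eq0 ?joukowskiV //.
by rewrite normfV invf_le1 // normr_gt0.
Qed.

Lemma sqrt_branch_exists : exists s : C -> C, sqrt_branch s.
Proof.
have [z zP] := choice joukowski_disc.
have z0 x : z x != 0 by have [] := zP x.
have z1 x : `|z x| <= 1 by have [] := zP x.
have zJ x : joukowski (z x) = x by have [] := zP x.
pose s x := x - z x.
have sE x : s x ^+ 2 = x ^+ 2 - 1.
  by rewrite /s -{1 3}(zJ x) /joukowski; field.
exists s; split=> [x _|x xS|e e0]; first exact: sE.
- have zlt1 : `|z x| < 1.
    rewrite lt_neqAle z1 andbT; apply/eqP => h; apply: xS.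
    by rewrite -(zJ x); exact: joukowski_slit.
  pose p (h : C^o) : C^o := s (h + x) + s x.
  pose D := `|(z x)^-1| - 1.
  have D0 : 0 < D by rewrite subr_gt0 normfV invf_gt1 // normr_gt0.
  have pE h : (s (h + x) - s x) * p h = h * (h + 2 * x).
    rewrite /p -subr_sqr !sE; ring.
  have xs : x + s x = (z x)^-1.
    by rewrite /s -{1 2}(zJ x) /joukowski; field.
  have pD h : D - `|h| <= `|p h|.
    have -> : p h = (z x)^-1 - (z (h + x) - h).
      by rewrite -xs /p {1}/s; ring.
    apply: le_trans (lerB_dist _ _).
    rewrite /D -addrA -opprD lerD2l lerN2.
    by apply: le_trans (ler_normB _ _) _; rewrite lerD2r.
  have D2 : 0 < D / 2 by rewrite divr_gt0.
  have nearD : \forall h \near (0 : C^o)^', D / 2 <= `|p h|.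
    have := @dnbhs0_le _ C^o _ D2; apply: filterS => h hD.
    apply: le_trans (pD h); rewrite lerBrDr.
    by rewrite {2}[D]splitr lerD2l.
  have sC : (s (h + x) : C^o) @[h --> (0 : C^o)^'] --> (s x : C^o).
    apply/cvgrPdist_le => e e0.
    pose K := (1 + `|2 * x|) / (D / 2).
    have K0 : 0 < K by rewrite divr_gt0 // ltr_wpDr.
    have eK : 0 < e / K by rewrite divr_gt0.
    near=> h.
    have hD : D / 2 <= `|p h| by near: h.
    have h1 : `|h| <= 1 by near: h; exact: (@dnbhs0_le _ C^o).
    have he : `|h| <= e / K by near: h; exact: (@dnbhs0_le _ C^o).
    have p0 : 0 < `|p h| by apply: lt_le_trans hD.
    rewrite distrC -(ler_pM2r p0) -normrM pE normrM.
    apply: le_trans (_ : e / K * (1 + `|2 * x|) <= _).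
      apply: ler_pM => //; apply: le_trans (ler_normD _ _) _.
      by rewrite lerD2r.
    rewrite /K invf_div mulrA mulfVK; last by rewrite gt_eqF // ltr_wpDr.
    by rewrite ler_pM2l.
  have pC : p h @[h --> (0 : C^o)^'] --> (s x + s x : C^o).
    by apply: cvgD => //; exact: cvg_cst.
  have s0 : s x + s x != 0.
    rewrite -mulr2n mulrn_eq0 /=; apply/eqP => h.
    have := zlt1; have : z x = x by rewrite -[RHS]subr0 -h /s; ring.
    move=> ->; move: (sE x); rewrite h expr0n /= => /esym/eqP.
    rewrite subr_eq0 => /eqP x1.
    have : `|x| ^+ 2 = 1 by rewrite -normrX x1 normr1.
    by move/eqP; rewrite sqrp_eq1 // => /eqP ->; rewrite ltxx.
  apply/cvg_ex; exists ((0 + 2 * x) / (s x + s x)).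
  have : (h + 2 * x) / p h @[h --> (0 : C^o)^'] -->
         ((0 + 2 * x) / (s x + s x) : C^o).
    apply: cvgM; last exact: cvgV.
    apply: cvgD; last exact: cvg_cst.
    exact: cvg_within.
  apply: cvg_trans; apply: near_eq_cvg.
  near=> h.
  have h0 : h != 0 by near: h; exact: nbhs_dnbhs_neq.
  have hD : D / 2 <= `|p h| by near: h.
  have p0 : p h != 0 by rewrite -normr_gt0; apply: lt_le_trans hD.
  rewrite /= /GRing.scale /= mulr1.
  apply: (mulfI h0); rewrite mulrA -pE mulfK //.
  by rewrite mulrA divff // mul1r.
- have e1 : 0 < e^-1 by rewrite invr_gt0.
  exists (1 + e^-1) => [|x xM]; first by rewrite addr_gt0.
  have x0 : 0 < `|x| by apply: lt_trans xM; rewrite addr_gt0.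
  have -> : s x / x - 1 = - (z x / x).
    by rewrite /s mulrBl divff -?normr_gt0 // addrAC subrr add0r.
  rewrite normrN normrM normfV ltr_pdivrMr //.
  apply: le_lt_trans (z1 x) _.
  rewrite -(ltr_pM2l e1) mulr1 mulrA mulVf ?gt_eqF // mul1r.
  by apply: le_lt_trans xM; rewrite lerDr.
Unshelve. all: by end_near.
Qed.

End ChebyshevRational.

(* Main.v *)
Require Import Defs.
From HB Require Import structures.
From mathcomp Require Import all_boot all_order all_algebra.
From mathcomp Require Import complex.
From mathcomp Require Import all_classical all_reals all_analysis.
From mathcomp Require Import ring.

Set Implicit Arguments.
Unset Strict Implicit.
Unset Printing Implicit Defensive.

Import Order.TTheory GRing.Theory Num.Theory.
Import numFieldNormedType.Exports.

Local Open Scope classical_set_scope.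
Local Open Scope ring_scope.

(** Fix [x = joukowski z] and put [w = (z - z^-1) / 2].  For one parameter
    [c = a - s], so that [a = joukowski c] and [s = (c^-1 - c) / 2], the factor
    [r = (z - c) / (1 - c * z)] satisfies
      [(x - a) / s * r = - ((a * x - 1) / s + w)]  and
      [(x - a) / s / r = - ((a * x - 1) / s - w)]
    ([blaschke_mul], [blaschke_div]).  The point is that [w] does not depend on
    [c].  Hence in the recurrence applied to [f_n], with [f_(n+1) = f_n * r_(n+1)]
    and [f_(n-1) = f_n / r_n], the two outer terms cancel the middle one: the
    [(a * x - 1) / s] parts do so one by one and the contributions of [w] have
    opposite signs.  Replacing [w] by [- w] gives the same for [1 / f_n].  By
    linearity every combination [p * f_n + q / f_n], with [p] and [q] depending
    on [x] only, solves the recurrence ([f_cheb_recurrence]); [T_n] and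
    [U_(n-1)] are two of them.

    For [U] the points [x = 1] and [x = -1] are exceptional, since its formula
    has a removable singularity there.  The recurrence, solved for its
    leading term, shows by induction that the limits exist, and then the
    recurrence passes to the limit ([chebU_formula_is_cvg], [chebU_recurrence]).

    Uniqueness is clear because the leading coefficient [(x - a_(n+1)) / s_(n+1)]
    vanishes only at the pole [a_(n+1)]. *)

(** * The recurrence and its initial value problem *)

Lemma off_polesS (R : realType) (a : nat -> R[i]) (n : nat) (x : R[i]) :
  off_poles a n.+1 x -> off_poles a n x.
Proof. by move=> ax k /andP[k1 kn]; apply: ax; rewrite k1 leqW. Qed.

Lemma off_poles_last (R : realType) (a : nat -> R[i]) (n : nat) (x : R[i]) :
  off_poles a n.+1 x -> x != a n.+1.
Proof. by apply; rewrite leqnn. Qed.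

Section InitialValueProblem.
Variables (R : realType) (s : R[i] -> R[i]) (a : nat -> R[i]).
Hypothesis s_neq0 : forall k, (1 <= k)%N -> s (a k) != 0.

Lemma leading_coef_neq0 (n : nat) (x : R[i]) :
  x != a n.+1 -> (x - a n.+1) / s (a n.+1) != 0.
Proof. by move=> xa; rewrite mulf_neq0 ?invr_eq0 ?s_neq0 // subr_eq0. Qed.

Lemma recurrence_unique (u v : nat -> R[i] -> R[i]) :
    solves_recurrence s a u -> solves_recurrence s a v ->
    (forall x, u 0%N x = v 0%N x) ->
    (forall x, x != a 1%N -> u 1%N x = v 1%N x) ->
  forall n x, off_poles a n x -> u n x = v n x.
Proof.
move=> us vs uv0 uv1 n x.
suff: (off_poles a n x -> u n x = v n x) /\
      (off_poles a n.+1 x -> u n.+1 x = v n.+1 x) by case.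
elim: n => [|n [IHn IHSn]]; first by split=> // /off_poles_last; exact: uv1.
split=> // ax; apply: (mulfI (leading_coef_neq0 (off_poles_last ax))).
have := us n.+1 x isT ax; have := vs n.+1 x isT ax => /=.
have ax1 := off_polesS ax.
rewrite (IHSn ax1) (IHn (off_polesS ax1)) => <-.
by rewrite -!addrA => /addIr.
Qed.

Lemma eq_solves_recurrence (u v : nat -> R[i] -> R[i]) :
    (forall n x, off_poles a n x -> u n x = v n x) ->
  solves_recurrence s a v -> solves_recurrence s a u.
Proof.
move=> uv vs [//|n] x _ ax; have ax1 := off_polesS ax.
by rewrite /= !uv //; [exact: (vs n.+1) | exact: off_polesS].
Qed.

Lemma recurrence_ivpP (v : nat -> R[i] -> R[i]) (i0 i1 : R[i] -> R[i]) :
    solves_recurrence s a v -> (forall x, v 0%N x = i0 x) ->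
    (forall x, x != a 1%N -> v 1%N x = i1 x) ->
  forall u : nat -> R[i] -> R[i],
    (solves_recurrence s a u /\ (forall x, u 0%N x = i0 x)
     /\ (forall x, x != a 1%N -> u 1%N x = i1 x))
    <-> (forall n x, off_poles a n x -> u n x = v n x).
Proof.
move=> vs v0 v1 u; split=> [[us [u0 u1]]|uv].
  apply: recurrence_unique => // x; first by rewrite u0 v0.
  by move=> xa; rewrite u1 ?v1.
split; first exact: eq_solves_recurrence uv vs.
split=> x => [|xa]; first by rewrite uv ?v0 // => -[].
by rewrite uv ?v1 // => -[|[|k]].
Qed.

End InitialValueProblem.

(** * The factors of [f_n] *)

Section Blaschke.
Variables (R : realType) (z c : R[i]).
Hypotheses (z0 : z != 0) (c0 : c != 0).

Lemma joukowski_subE :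
  joukowski z - joukowski c = - ((z - c) * (1 - c * z)) / (2 * c * z).
Proof. by rewrite /joukowski; field; rewrite z0 c0. Qed.

Hypothesis c1 : 1 - c ^+ 2 != 0.
Hypothesis zc : joukowski z != joukowski c.

Lemma blaschke_neq0 : (z - c != 0) /\ (1 - c * z != 0).
Proof.
move: zc; rewrite -subr_eq0 joukowski_subE mulf_eq0 oppr_eq0 mulf_eq0.
by rewrite !negb_or => /andP[/andP[-> ->]].
Qed.

(** With [s] written as [(c^-1 - c) / 2], the identity
    [(z - c)^2 - (1 - c z)^2 = (z^2 - 1)(1 - c^2)] makes the antisymmetric part
    [(z - z^-1) / 2] lose all dependence on [c]. *)
Lemma blaschke_mul (x := joukowski z) (a := joukowski c) (s := 2^-1 * (c^-1 - c)) :
  (x - a) / s * ((z - c) / (1 - c * z)) =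
  - ((a * x - 1) / s + 2^-1 * (z - z^-1)).
Proof.
have [zc0 zc1] := blaschke_neq0; rewrite /x /a /s /joukowski.
by field; rewrite z0 c0 zc1 mulNr -expr2 c1.
Qed.

Lemma blaschke_div (x := joukowski z) (a := joukowski c) (s := 2^-1 * (c^-1 - c)) :
  (x - a) / s * ((z - c) / (1 - c * z))^-1 =
  - ((a * x - 1) / s - 2^-1 * (z - z^-1)).
Proof.
have [zc0 zc1] := blaschke_neq0; rewrite /x /a /s /joukowski.
by field; rewrite z0 c0 zc1 zc0 mulNr -expr2 c1.
Qed.

End Blaschke.

Lemma f_cheb0 (R : realType) (c : nat -> R[i]) (z : R[i]) : f_cheb c 0 z = 1.
Proof. by rewrite /f_cheb big_nil. Qed.

Lemma f_chebS (R : realType) (c : nat -> R[i]) (n : nat) (z : R[i]) :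
  f_cheb c n.+1 z = f_cheb c n z * ((z - c n.+1) / (1 - c n.+1 * z)).
Proof. by rewrite /f_cheb big_nat_recr. Qed.

(** * Solutions of the recurrence *)

Section Solutions.
Variables (R : realType) (s : R[i] -> R[i]) (a : nat -> R[i]).
Hypothesis s_branch : sqrt_branch s.
Hypothesis a_slit : forall k, (1 <= k)%N -> ~ slit (a k).
Let c := cpar s a.

Let s_sqr k : (1 <= k)%N -> s (a k) ^+ 2 = a k ^+ 2 - 1.
Proof. by move=> k1; case: s_branch => sE _ _; apply/sE/a_slit. Qed.

Lemma s_neq0 k : (1 <= k)%N -> s (a k) != 0.
Proof.
move=> k1; apply/negP => /eqP s0; apply: (a_slit k1).
have /esym/eqP := s_sqr k1; rewrite s0 expr0n /= subr_eq0 sqrf_eq1.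
by case/orP => /eqP ->; rewrite /slit /= lexx ?andbT (@ge0_cp _ 1).
Qed.

Lemma cpar_mul k : (1 <= k)%N -> c k * (a k + s (a k)) = 1.
Proof.
by move=> k1; rewrite /c /cpar -subr_sqr s_sqr // opprB addrC subrK.
Qed.

Lemma cpar_neq0 k : (1 <= k)%N -> c k != 0.
Proof.
move=> k1; apply/eqP => c0; have := cpar_mul k1.
by rewrite c0 mul0r => /esym/eqP; rewrite oner_eq0.
Qed.

Lemma cparV k : (1 <= k)%N -> (c k)^-1 = a k + s (a k).
Proof.
by move=> k1; apply: (mulfI (cpar_neq0 k1)); rewrite cpar_mul ?divff ?cpar_neq0.
Qed.

Lemma joukowski_cpar k : (1 <= k)%N -> a k = joukowski (c k).
Proof. by move=> k1; rewrite /joukowski cparV // /c /cpar; field. Qed.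

Lemma s_cpar k : (1 <= k)%N -> s (a k) = 2^-1 * ((c k)^-1 - c k).
Proof. by move=> k1; rewrite cparV // /c /cpar; field. Qed.

Lemma cpar_sqr_neq1 k : (1 <= k)%N -> 1 - c k ^+ 2 != 0.
Proof.
move=> k1; have -> : 1 - c k ^+ 2 = 2 * c k * s (a k).
  by rewrite s_cpar //; field; exact: cpar_neq0.
by rewrite !mulf_neq0 ?s_neq0 ?cpar_neq0 ?pnatr_eq0.
Qed.

Section Factor.
Variables (z : R[i]) (k : nat).
Hypotheses (z0 : z != 0) (k1 : (1 <= k)%N) (za : joukowski z != a k).
Let zc : joukowski z != joukowski (c k). Proof. by rewrite -joukowski_cpar. Qed.

Lemma factor_neq0 : (z - c k) / (1 - c k * z) != 0.
Proof.
have [? ?] := blaschke_neq0 z0 (cpar_neq0 k1) zc.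
by rewrite mulf_neq0 ?invr_eq0.
Qed.

Lemma factor_mul :
  (joukowski z - a k) / s (a k) * ((z - c k) / (1 - c k * z)) =
  - ((a k * joukowski z - 1) / s (a k) + 2^-1 * (z - z^-1)).
Proof.
have := blaschke_mul z0 (cpar_neq0 k1) (cpar_sqr_neq1 k1) zc.
by rewrite /= -joukowski_cpar // -s_cpar.
Qed.

Lemma factor_div :
  (joukowski z - a k) / s (a k) * ((z - c k) / (1 - c k * z))^-1 =
  - ((a k * joukowski z - 1) / s (a k) - 2^-1 * (z - z^-1)).
Proof.
have := blaschke_div z0 (cpar_neq0 k1) (cpar_sqr_neq1 k1) zc.
by rewrite /= -joukowski_cpar // -s_cpar.
Qed.

End Factor.

(** [blaschke_mul] turns [A_(n+1) f_(n+1)] into a multiple of [f_n], and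
    [blaschke_div] does the same for [A_n f_(n-1)], where [A_k] stands for
    [(x - a_k) / s_k].  The combination of [f_n] and [1 / f_n] has coefficients
    independent of [n], so that [T_n] and [U_(n-1)] are both instances. *)
Lemma f_cheb_recurrence (p q z : R[i]) (n : nat) (x := joukowski z)
    (u := fun m => p * f_cheb c m z + q * (f_cheb c m z)^-1) :
    z != 0 -> (1 <= n)%N -> x != a n -> x != a n.+1 ->
  (x - a n.+1) / s (a n.+1) * u n.+1
  + ((a n.+1 * x - 1) / s (a n.+1) + (a n * x - 1) / s (a n)) * u n
  + (x - a n) / s (a n) * u n.-1 = 0.
Proof.
case: n => [//|n] z0 _ xa xa1 /=; rewrite /u !f_chebS.
have := factor_neq0 z0 (isT : 1 <= n.+1)%N xa.
have := factor_mul z0 (isT : 1 <= n.+1)%N xa.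
have := factor_div z0 (isT : 1 <= n.+1)%N xa.
have := factor_mul z0 (isT : 1 <= n.+2)%N xa1.
have := factor_div z0 (isT : 1 <= n.+2)%N xa1.
rewrite -/x.
move: (f_cheb c n z) ((z - c n.+1) / _) ((z - c n.+2) / _) => f r r'.
move: ((x - a n.+1) / _) ((x - a n.+2) / _) => A A'.
move: ((_ - 1) / _) ((_ - 1) / _) (2^-1 * _) => B' B w Ed' Em' Ed Em r0.
rewrite !invfM.
have Ar : r * (A * r^-1) = A by rewrite mulrC mulfVK.
have ArV : r^-1 * (A * r) = A by rewrite mulrC mulfK.
transitivity (p * f * (r * (A' * r' + (B' + B)) + A) +
              q * f^-1 * (r^-1 * (A' * r'^-1 + (B' + B)) + A)).
  by ring.
rewrite -{1}Ar -[X in _ + _ * (_ + X)]ArV Em Ed Em' Ed'.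
by ring.
Qed.

Lemma chebT_recurrence : solves_recurrence s a (chebT c).
Proof.
move=> n x n1; have [z [z0 <-]] := joukowski_surj x => ax.
have TE m : chebT c m (joukowski z) =
    2^-1 * f_cheb c m z + 2^-1 * (f_cheb c m z)^-1 by rewrite chebTE // mulrDr.
rewrite !TE; apply: (@f_cheb_recurrence 2^-1 2^-1 z n) => //; apply: ax.
  by rewrite n1 leqnSn.
by rewrite leqnn.
Qed.

Lemma chebU_formula_recurrence (n : nat) (x : R[i])
    (u := fun m : nat => chebU_formula c (m%:Z - 1) x) :
    (1 <= n)%N -> x != a n -> x != a n.+1 ->
  (x - a n.+1) / s (a n.+1) * u n.+1
  + ((a n.+1 * x - 1) / s (a n.+1) + (a n * x - 1) / s (a n)) * u n
  + (x - a n) / s (a n) * u n.-1 = 0.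
Proof.
move=> n1; rewrite /u; have [z [z0 <-]] := joukowski_surj x => xa xa1.
have uE m : chebU_formula c (m%:Z - 1) (joukowski z) =
    (z - z^-1)^-1 * f_cheb c m z + - (z - z^-1)^-1 * (f_cheb c m z)^-1.
  by rewrite chebU_formulaE // subrK mulrBr mulNr.
rewrite !uE; exact: (@f_cheb_recurrence (z - z^-1)^-1 (- (z - z^-1)^-1) z n).
Qed.

Lemma chebT0 (x : R[i]) : chebT c 0 x = 1.
Proof. by rewrite /chebT f_cheb0 invr1; field. Qed.

Lemma chebT1 (x : R[i]) :
  x != a 1%N -> chebT c 1 x = (1 - a 1%N * x) / (x - a 1%N).
Proof.
have [z [z0 <-]] := joukowski_surj x => xa.
rewrite chebTE // f_chebS f_cheb0 mul1r.
apply: (mulfI (leading_coef_neq0 s_neq0 xa)).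
rewrite mulrCA mulrDr factor_mul // factor_div //.
by field; rewrite s_neq0 // subr_eq0 xa.
Qed.

Lemma chebU_formulaN1 (x : R[i]) : chebU_formula c (0%:Z - 1) x = 0.
Proof. by rewrite /chebU_formula subrK f_cheb0 invr1 subrr mulr0. Qed.

Lemma chebU_formula0 (x : R[i]) : x ^+ 2 != 1 -> x != a 1%N ->
  chebU_formula c (1%:Z - 1) x = - (s (a 1%N) / (x - a 1%N)).
Proof.
have [z [z0 <-]] := joukowski_surj x; rewrite joukowski_sqr1 // => z1 xa.
rewrite chebU_formulaE // subrK f_chebS f_cheb0 mul1r.
apply: (mulfI (leading_coef_neq0 s_neq0 xa)).
rewrite mulrCA mulrBr factor_mul // factor_div //.
transitivity (- ((z - z^-1)^-1 * (z - z^-1))).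
  by move: (z - z^-1)^-1 ((_ - 1) / _) => p B; field.
by rewrite mulVf //; field; rewrite s_neq0 // subr_eq0 xa.
Qed.

(** * The removable singularities of [U_n] *)

Lemma near_dnbhs_neq (x y : R[i]) : \forall t \near (x : R[i]^o)^', t != y.
Proof.
have [<-|xy] := eqVneq x y; first exact: (@nbhs_dnbhs_neq R[i]^o).
have : (t - y : R[i]^o) @[t --> (x : R[i]^o)^'] --> (x - y : R[i]^o).
  by apply: cvgB; [exact: cvg_within | exact: cvg_cst].
move/cvgr_neq0; rewrite subr_eq0 => /(_ xy).
by apply: filterS => t; rewrite subr_eq0.
Qed.

Lemma leading_coef_cvg (k : nat) (x : R[i]) :
  ((t - a k) / s (a k) : R[i]^o) @[t --> (x : R[i]^o)^'] -->
  ((x - a k) / s (a k) : R[i]^o).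
Proof.
apply: cvgM; last exact: cvg_cst.
by apply: cvgB; [exact: cvg_within | exact: cvg_cst].
Qed.

Lemma middle_coef_cvg (k : nat) (x : R[i]) :
  ((a k * t - 1) / s (a k) : R[i]^o) @[t --> (x : R[i]^o)^'] -->
  ((a k * x - 1) / s (a k) : R[i]^o).
Proof.
apply: cvgM; last exact: cvg_cst.
have xx : t @[t --> (x : R[i]^o)^'] --> (x : R[i]^o) by exact: cvg_within.
exact: (cvgB (cvgM (cvg_cst (a k : R[i]^o)) xx) (cvg_cst (1 : R[i]^o))).
Qed.

Lemma chebU_formula0_cvg (x : R[i]) : x != a 1%N ->
  (chebU_formula c (1%:Z - 1) t : R[i]^o) @[t --> (x : R[i]^o)^'] -->
  (- (s (a 1%N) / (x - a 1%N)) : R[i]^o).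
Proof.
move=> xa.
have : (- (s (a 1%N) * (t - a 1%N)^-1) : R[i]^o) @[t --> (x : R[i]^o)^'] -->
       (- (s (a 1%N) * (x - a 1%N)^-1) : R[i]^o).
  apply: cvgN; apply: cvgM; first exact: cvg_cst.
  apply: cvgV; first by rewrite subr_eq0.
  by apply: cvgB; [exact: cvg_within | exact: cvg_cst].
apply: cvg_trans; apply: near_eq_cvg; near=> t.
have t1 : t != 1 by near: t; exact: near_dnbhs_neq.
have tN1 : t != -1 by near: t; exact: near_dnbhs_neq.
have ta : t != a 1%N by near: t; exact: near_dnbhs_neq.
by rewrite chebU_formula0 // sqrf_eq1 negb_or t1.
Unshelve. all: by end_near.
Qed.

(** The recurrence gives each term from the two preceding ones after a division
    by [(x - a_(n+1)) / s_(n+1)], which is continuous and nonzero off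
    [a_(n+1)]; so the existence of limits propagates. *)
Lemma chebU_formula_is_cvg (n : nat) (x : R[i]) : off_poles a n x ->
  cvg ((chebU_formula c (n%:Z - 1) t : R[i]^o) @[t --> (x : R[i]^o)^']).
Proof.
pose F n t : R[i]^o := chebU_formula c (n%:Z - 1) t.
suff: (off_poles a n x -> cvg (F n t @[t --> (x : R[i]^o)^'])) /\
      (off_poles a n.+1 x -> cvg (F n.+1 t @[t --> (x : R[i]^o)^'])) by case.
elim: n => [|n [IHn IHSn]]; split=> // ax.
- rewrite [F 0%N](_ : _ = cst 0); first exact: is_cvg_cst.
  by apply/funext => t; exact: chebU_formulaN1.
- by apply/cvg_ex; exists (- (s (a 1%N) / (x - a 1%N)));
    exact: (chebU_formula0_cvg (off_poles_last ax)).
- have ax1 := off_polesS ax; have xa := off_poles_last ax.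
  have /cvg_ex[l Fl] := IHn (off_polesS ax1).
  have /cvg_ex[l1 Fl1] := IHSn ax1.
  pose G t : R[i]^o := ((t - a n.+2) / s (a n.+2))^-1 *
    - (((a n.+2 * t - 1) / s (a n.+2) + (a n.+1 * t - 1) / s (a n.+1)) * F n.+1 t
       + (t - a n.+1) / s (a n.+1) * F n t).
  have [L GL] : exists L : R[i]^o, G t @[t --> (x : R[i]^o)^'] --> L.
    have A0 := leading_coef_neq0 s_neq0 xa.
    eexists; apply: (cvgM (cvgV A0 (@leading_coef_cvg n.+2 x))).
    apply: (cvgN (cvgD _ (cvgM (@leading_coef_cvg n.+1 x) Fl))).
    exact: (cvgM (cvgD (@middle_coef_cvg n.+2 x) (@middle_coef_cvg n.+1 x)) Fl1).
  apply/cvg_ex; exists L; move: GL.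
  apply: cvg_trans; apply: near_eq_cvg; near=> t.
  have ta1 : t != a n.+1 by near: t; exact: near_dnbhs_neq.
  have ta2 : t != a n.+2 by near: t; exact: near_dnbhs_neq.
  have A20t := leading_coef_neq0 s_neq0 ta2.
  have /eqP := @chebU_formula_recurrence n.+1 t isT ta1 ta2.
  rewrite -addrA addr_eq0 => /eqP E.
  by apply: (mulfI A20t); rewrite /G /F E mulrA mulfV // mul1r.
Unshelve. all: by end_near.
Qed.

Lemma chebU_formula_cvg (n : nat) (x : R[i]) :
    x ^+ 2 = 1 -> off_poles a n x ->
  (chebU_formula c (n%:Z - 1) t : R[i]^o) @[t --> (x : R[i]^o)^'] -->
    (chebU c (n%:Z - 1) x : R[i]^o).
Proof. by move=> x1 ax; rewrite /chebU x1 eqxx; exact: chebU_formula_is_cvg. Qed.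

Lemma chebU_recurrence : solves_recurrence s a (fun n => chebU c (n%:Z - 1)).
Proof.
move=> [//|n] x _ ax; have ax1 := off_polesS ax.
have xa := off_poles_last ax; have xa1 := off_poles_last ax1.
have [x1|x1] := eqVneq (x ^+ 2) 1; last first.
  by rewrite /chebU (negPf x1); exact: chebU_formula_recurrence.
(* The left-hand side of the recurrence vanishes near [x], hence so does its
   limit at [x]. *)
pose G t : R[i]^o := (t - a n.+2) / s (a n.+2) * chebU_formula c (n.+2%:Z - 1) t
  + ((a n.+2 * t - 1) / s (a n.+2) + (a n.+1 * t - 1) / s (a n.+1))
    * chebU_formula c (n.+1%:Z - 1) t
  + (t - a n.+1) / s (a n.+1) * chebU_formula c (n%:Z - 1) t.
suff G0 : G t @[t --> (x : R[i]^o)^'] --> (0 : R[i]^o).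
  apply: (cvg_unique (@norm_hausdorff _ R[i]^o) _ G0).
  exact: (cvgD (cvgD
    (cvgM (@leading_coef_cvg n.+2 x) (chebU_formula_cvg x1 ax))
    (cvgM (cvgD (@middle_coef_cvg n.+2 x) (@middle_coef_cvg n.+1 x))
          (chebU_formula_cvg x1 ax1)))
    (cvgM (@leading_coef_cvg n.+1 x) (chebU_formula_cvg x1 (off_polesS ax1)))).
have : cst (0 : R[i]^o) t @[t --> (x : R[i]^o)^'] --> (0 : R[i]^o) by exact: cvg_cst.
apply: cvg_trans; apply: near_eq_cvg; near=> t.
have ta1 : t != a n.+1 by near: t; exact: near_dnbhs_neq.
have ta2 : t != a n.+2 by near: t; exact: near_dnbhs_neq.
exact/esym/(@chebU_formula_recurrence n.+1).
Unshelve. all: by end_near.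
Qed.

Lemma chebUN1 (x : R[i]) : chebU c (0%:Z - 1) x = 0.
Proof.
rewrite /chebU chebU_formulaN1; case: ifP => // _.
apply: (cvg_lim (@norm_hausdorff _ R[i]^o)).
rewrite [chebU_formula _ _](_ : _ = cst 0); first exact: cvg_cst.
by apply/funext => t; exact: chebU_formulaN1.
Qed.

Lemma chebU0 (x : R[i]) : x != a 1%N ->
  chebU c (1%:Z - 1) x = - (s (a 1%N) / (x - a 1%N)).
Proof.
move=> xa; rewrite /chebU; case: ifPn => [_|x1]; last exact: chebU_formula0.
exact/(cvg_lim (@norm_hausdorff _ R[i]^o))/chebU_formula0_cvg.
Qed.

End Solutions.

Theorem theorem4p1 (R : realType) (s : R[i] -> R[i]) (a : nat -> R[i])
    (s_branch : sqrt_branch s)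
    (a_slit : forall k, (1 <= k)%N -> ~ slit (a k))
    (a_inj : forall j k, (1 <= j)%N -> (1 <= k)%N -> a j = a k -> j = k) :
  let c := cpar s a in
  [/\ solves_recurrence s a (chebT c),
      solves_recurrence s a (fun n => chebU c (n%:Z - 1)),
      forall u : nat -> R[i] -> R[i],
        (solves_recurrence s a u
         /\ (forall x, u 0%N x = 1)
         /\ (forall x, x != a 1%N -> u 1%N x = (1 - a 1%N * x) / (x - a 1%N)))
        <-> (forall n x, off_poles a n x -> u n x = chebT c n x)
    & forall u : nat -> R[i] -> R[i],
        (solves_recurrence s a u
         /\ (forall x, u 0%N x = 0)
         /\ (forall x, x != a 1%N -> u 1%N x = - (s (a 1%N) / (x - a 1%N))))
        <-> (forall n x, off_poles a n x -> u n x = chebU c (n%:Z - 1) x)].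
Proof.
move=> c; have s0 := s_neq0 s_branch a_slit; split.
- exact: chebT_recurrence.
- exact: chebU_recurrence.
- apply: (recurrence_ivpP s0 (i0 := fun=> 1)).
  + exact: chebT_recurrence.
  + exact: chebT0.
  + exact: chebT1.
- apply: (recurrence_ivpP s0 (i0 := fun=> 0) (v := fun n => chebU c (n%:Z - 1))).
  + exact: chebU_recurrence.
  + exact: chebUN1.
  + exact: chebU0.
Qed.
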